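(* Let $\widetilde{A}$ be the row-normalized adjacency matrix of a weighted directed graph with $N$ nodes. Suppose that all nodes have exponential waiting-time distributions, where node $i$ has rate parameter $\lambda_i>0$. Let $\Lambda$ be the diagonal matrix with entries $\Lambda_{ii}=\lambda_i$, and let $I$ be the identity matrix. If the matrix $Z=\Lambda(\widetilde{A}-I)$ is diagonalizable with eigenvalue--eigenvector pairs $\{\nu_d,v_d\}_{d=1,\dots,N}$ and $\{v_d\}$ are linearly independent, then the opinion model $$\dot{x}_i(t)=\lambda_i\sum_j\widetilde{A}_{ij}x_j(t)-\lambda_ix_i(t),\qquad i=1,\dots,N,$$ with initial vector $x(0)\in\mathbb{R}^N$ converges to a steady state $x^*$. Additionally, $x^*$ satisfies $$\lim_{t\to\infty}x(t)=x^*=\sum_{\{d:\ \nu_d=0\}}c_d^0v_d,$$ where $c_d^0$ is the coefficient of $v_d$ in the decomposition of $x(0)$ in terms of the basis $\{v_d\}_{d=1,\dots,N}$.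
   Context: Graph: $A\in\mathbb{R}^{N\times N}$ is an adjacency matrix with nonnegative real entries ($A_{ij}$ is the weight of the edge from node $i$ to node $j$; self-edges are allowed), and each row sum of $A$ is larger than $0$. The row-normalized adjacency matrix is $\widetilde{A}_{ij}=A_{ij}/\sum_{l=1}^N A_{il}$. The displayed linear system of ordinary differential equations is the opinion model that is induced by the exponential waiting-time distributions $T_i(t)=\lambda_ie^{-\lambda_it}$; here $x_i(t)$ is the expected opinion of entity (node) $i$ at time $t\ge0$. *)

(* Defs.v *)
From HB Require Import structures.
From mathcomp Require Import all_boot all_order all_algebra.
From mathcomp Require Import all_classical all_reals all_analysis.
From mathcomp Require Import complex.
Set Implicit Arguments.
Unset Strict Implicit.
Unset Printing Implicit Defensive.
Import Order.TTheory GRing.Theory Num.Theory.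
Import numFieldNormedType.Exports.
Local Open Scope classical_set_scope.
Local Open Scope ring_scope.

Definition row_normalize (R : realType) (N : nat) (A : 'M[R]_N) : 'M[R]_N :=
  \matrix_(i, j) (A i j / \sum_l A i l).

Definition opinion_matrix (R : realType) (N : nat) (A : 'M[R]_N)
    (lambda : 'I_N -> R) : 'M[R]_N :=
  diag_mx (\row_i lambda i) *m (row_normalize A - 1%:M).

Definition opinion_rhs (R : realType) (N : nat) (A : 'M[R]_N)
    (lambda : 'I_N -> R) (y : 'cV[R]_N) (i : 'I_N) : R :=
  lambda i * (\sum_j row_normalize A i j * y j 0) - lambda i * y i 0.

(* [x] is a total function on R, but only its values at t >= 0 matter.
   Right continuity at 0 ties the initial vector to the values at t > 0; the
   one-sided differential equation at 0 then follows. *)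
Definition opinion_solution (R : realType) (N : nat) (A : 'M[R]_N)
    (lambda : 'I_N -> R) (x : R -> 'cV[R]_N) : Prop :=
  (forall t : R, 0 < t -> forall i : 'I_N,
     is_derive t 1 (fun s : R => x s i 0) (opinion_rhs A lambda (x t) i)) /\
  (x t @[t --> (0 : R)^'+] --> x 0).

Definition steady_state (R : realType) (N : nat) (A : 'M[R]_N)
    (lambda : 'I_N -> R) (y : 'cV[R]_N) : Prop :=
  forall i : 'I_N, opinion_rhs A lambda y i = 0.

(* A real matrix seen over R[i], where eigenvalues and eigenvectors live. *)
Definition complexify (R : realType) (m n : nat) (M : 'M[R]_(m, n)) :
    'M[R[i]]_(m, n) :=
  map_mx (real_complex R) M.

(* Main.v *)
(* By Gershgorin, every eigenvalue nu_d of Z = Lambda (A~ - I) is 0 or has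
   negative real part. In the eigenbasis the system decouples: the coordinate
   c_d of x(t) satisfies c_d' = nu_d c_d, so it is constant when nu_d = 0 and
   tends to 0 otherwise. Summing gives the limit, which is real because x(t) is,
   and which Z annihilates. *)

Require Import Defs.
From HB Require Import structures.
From mathcomp Require Import all_boot all_order all_algebra.
From mathcomp Require Import all_classical all_reals all_analysis.
From mathcomp Require Import complex.
From mathcomp Require Import ring lra.
Set Implicit Arguments.
Unset Strict Implicit.
Unset Printing Implicit Defensive.
Import Order.TTheory GRing.Theory Num.Theory.
Import numFieldNormedType.Exports.
Local Open Scope classical_set_scope.
Local Open Scope ring_scope.

(** * Real and imaginary parts of complex sums and products *)

Lemma Re_sum (R : rcfType) (I : Type) (r : seq I) (P : pred I) (F : I -> R[i]) :
  complex.Re (\sum_(i <- r | P i) F i) = \sum_(i <- r | P i) complex.Re (F i).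
Proof. by apply: (big_morph (@complex.Re R)) => // -[a b] [c d]. Qed.

Lemma Im_sum (R : rcfType) (I : Type) (r : seq I) (P : pred I) (F : I -> R[i]) :
  complex.Im (\sum_(i <- r | P i) F i) = \sum_(i <- r | P i) complex.Im (F i).
Proof. by apply: (big_morph (@complex.Im R)) => // -[a b] [c d]. Qed.

Lemma ReM (R : rcfType) (z w : R[i]) :
  complex.Re (z * w) = complex.Re z * complex.Re w - complex.Im z * complex.Im w.
Proof. by case: z w => [a b] [c d]. Qed.

Lemma ImM (R : rcfType) (z w : R[i]) :
  complex.Im (z * w) = complex.Re z * complex.Im w + complex.Im z * complex.Re w.
Proof. by case: z w => [a b] [c d]. Qed.

(** * The opinion matrix and its spectrum *)

Lemma opinion_rhsE (R : realType) (N : nat) (A : 'M[R]_N) (lambda : 'I_N -> R)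
    (y : 'cV[R]_N) (i : 'I_N) :
  opinion_rhs A lambda y i = (opinion_matrix A lambda *m y) i 0.
Proof.
rewrite /opinion_matrix -mulmxA mul_diag_mx mulmxBl mul1mx !mxE.
by rewrite /opinion_rhs mulrBr.
Qed.

(* Comparing row i of Z w = nu w, for i maximizing |w_i|, gives the Gershgorin
   bound |nu + lambda_i| <= lambda_i; this disc meets the closed right
   half-plane only at 0. *)
Lemma opinion_matrix_eigenvalue (R : realType) (N : nat) (A : 'M[R]_N)
    (lambda : 'I_N -> R) (nu : R[i]) (w : 'cV[R[i]]_N) :
  (forall i j, 0 <= A i j) -> (forall i, 0 < \sum_l A i l) ->
  (forall i, 0 < lambda i) ->
  complexify (opinion_matrix A lambda) *m w = nu *: w -> w != 0 ->
  nu = 0 \/ complex.Re nu < 0.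
Proof.
move=> A0 row0 l0 eig w0.
have [i0 wi0] : exists i, w i 0 != 0.
  apply/existsP; apply: contraR w0 => /existsPn w0; apply/eqP/colP => i.
  by rewrite mxE; apply/eqP; have := w0 i; rewrite negbK.
(* [R[i]] is only partially ordered, so the maximum is taken over real moduli. *)
pose m i := ComplexField.Normc.normc (w i 0).
have mE i : (m i)%:C%C = `|w i 0| by [].
have [i _ imax] := Order.TotalTheory.arg_maxP m (erefl : predT i0).
have mi0 : 0 < m i.
  by apply: lt_le_trans (imax i0 isT); rewrite -ltcR mE normr_gt0.
have eqi : (nu + (lambda i)%:C%C) * w i 0 =
    (lambda i)%:C%C * \sum_j (row_normalize A i j)%:C%C * w j 0.
  have /colP/(_ i) := eig; rewrite mxE [RHS]mxE mulrDl => <-.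
  rewrite mulr_sumr.
  under eq_bigr => j _.
    rewrite mxE /opinion_matrix mul_diag_mx !mxE rmorphM rmorphB /= rmorph_nat.
    rewrite mulrBr mulrBl -mulrA; over.
  rewrite sumrB; under [X in _ - X + _]eq_bigr => j _.
    rewrite mulr_natr mulrb (fun_if (fun z => z * w j 0)) mul0r; over.
  rewrite -big_mkcond /= [X in _ - X](big_pred1 i) => [|j]; last exact: eq_sym.
  rewrite subrK; apply: eq_bigr => j _.
  by rewrite !mxE.
have rs1 : \sum_j row_normalize A i j = 1.
  under eq_bigr do rewrite mxE.
  by rewrite -mulr_suml divff// gt_eqF.
have rn0 j : 0 <= row_normalize A i j by rewrite mxE divr_ge0// ltW.
(* The normalized row averages moduli that are at most [|w i 0|], and this positive factor
   cancels. *)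
have : `|nu + (lambda i)%:C%C| <= (lambda i)%:C%C.
  rewrite -(@ler_pM2r _ `|w i 0|); last by rewrite -mE ltcR.
  rewrite -normrM eqi normrM ger0_norm; last by rewrite ler0c ltW.
  rewrite ler_pM2l; last by rewrite ltcR.
  apply: le_trans (ler_norm_sum _ _ _) _.
  have -> : `|w i 0| = \sum_j (row_normalize A i j)%:C%C * `|w i 0|.
    by rewrite -mulr_suml -rmorph_sum rs1 rmorph1 mul1r.
  apply: ler_sum => j _; rewrite normrM ger0_norm ?ler0c//.
  by rewrite ler_wpM2l ?ler0c// -!mE lecR; exact: imax.
(* With nu = p + iq, squaring gives p^2 + q^2 <= - 2 p lambda_i, which forces p = q = 0 when p >=
   0. *)
rewrite -(@ler_pXn2r _ 2%N)// ?nnegrE//; last by rewrite ler0c ltW.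
rewrite -add_Re2_Im2 -rmorphXn lecR.
case: nu {eig eqi} => p q /= hle; rewrite addr0 in hle.
have hl := l0 i.
have [p0|p0] := ltP p 0; [by right|left].
have p2 : 0 <= p * lambda i by rewrite mulr_ge0// ltW.
have pq : p ^+ 2 + q ^+ 2 <= 0 by lra.
have : p ^+ 2 + q ^+ 2 == 0 by rewrite eq_le pq addr_ge0 ?sqr_ge0.
by rewrite paddr_eq0 ?sqr_ge0// !sqrf_eq0 => /andP[/eqP-> /eqP->].
Qed.

(** * Scalar differential equations on the positive half-line *)

(** The mean value theorem applies on segments that avoid 0, where no derivative is assumed. *)
Lemma is_derive_pos_cst (R : realType) (f : R -> R) :
  (forall t : R, 0 < t -> is_derive t 1 f 0) ->
  forall s t : R, 0 < s -> 0 < t -> f s = f t.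
Proof.
move=> df.
have main (s t : R) : 0 < s -> s <= t -> f s = f t.
  move=> s0 st; have /(_ st) := @MVT_segment R f (fun=> 0) s t.
  case=> [r|/=|c _].
  - by rewrite in_itv /= => /andP[sr _]; apply: df; exact: lt_trans sr.
  - apply: derivable_within_continuous => r; rewrite in_itv /= => /andP[sr _].
    by have /df[] := lt_le_trans s0 sr.
  - by rewrite mul0r => /subr0_eq.
move=> s t s0 t0; have [|/ltW] := leP s t; first exact: main.
by move=> ts; rewrite (main t s).
Qed.

(** Passes from decay of a squared modulus to decay of the real and imaginary parts. *)
Lemma sqr_cvg0 (R : realType) (f g : R -> R) :
  (\forall t \near +oo, f t ^+ 2 <= g t) -> g t @[t --> +oo] --> 0 ->
  f t @[t --> +oo] --> 0.
Proof.
move=> fg g0; apply/cvgr0Pnorm_lt => e e0.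
have e20 : 0 < e ^+ 2 by rewrite exprn_gt0.
have /cvgr0Pnorm_lt/(_ _ e20) ge := g0.
near=> t.
rewrite -(@ltr_pXn2r _ 2%N)// ?nnegrE ?normr_ge0 ?(ltW e0)//.
rewrite real_normK ?num_real//.
have h1 : f t ^+ 2 <= g t by near: t.
apply: le_lt_trans h1 _; apply: le_lt_trans (ler_norm _) _.
by near: t.
Unshelve. all: by end_near. Qed.

(* With c = a + ib and nu = p + iq, this is the equation c' = nu c, for which
   |c|^2 exp(-2pt) is constant. *)
Lemma spiral_cvg0 (R : realType) (a b : R -> R) (p q : R) :
  p < 0 ->
  (forall t : R, 0 < t -> is_derive t 1 a (p * a t - q * b t)) ->
  (forall t : R, 0 < t -> is_derive t 1 b (p * b t + q * a t)) ->
  a t @[t --> +oo] --> 0 /\ b t @[t --> +oo] --> 0.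
Proof.
move=> p0 da db.
pose m (t : R) := a t ^+ 2 + b t ^+ 2.
pose g (t : R) := m t * expR (- (2 * p) * t).
have dg (t : R) : 0 < t -> is_derive t 1 g 0.
  move=> t0; have dat := da _ t0; have dbt := db _ t0.
  have dlin : is_derive t 1 (fun s : R => - (2 * p) * s) (- (2 * p)).
    by apply: is_derive_eq; rewrite /GRing.scale /= mulr1.
  have dexp : is_derive t 1 (fun s => expR (- (2 * p) * s))
     (expR (- (2 * p) * t) * - (2 * p)).
    exact: (@is_derive1_comp R expR (fun s : R => - (2 * p) * s)).
  (* The cross terms in q cancel, so m' = 2pm, which the exponential factor compensates. *)
  have := is_deriveM (is_deriveD (is_deriveX 1 dat) (is_deriveX 1 dbt)) dexp.
  move=> h; apply: is_derive_eq; rewrite /GRing.scale /= /m.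
  set E := expR _; rewrite ?fctE; ring.
(* The constant is read off at time 1, since the equation is not assumed at 0. *)
have mE (t : R) : 0 < t -> m t = g 1 * expR (2 * p * t).
  move=> t0; rewrite -(is_derive_pos_cst dg t0 ltr01) /g -mulrA -expRD.
  by rewrite mulNr addNr expR0 mulr1.
have gcvg : g 1 * expR (2 * p * t) @[t --> +oo] --> 0.
  rewrite -[X in _ --> X](mulr0 (g 1)); apply: cvgMr.
  (* As p < 0, the exponent is minus a quantity tending to +oo, the form that [cvgr_expR] takes. *)
  have h : (- (2 * p)) * t @[t --> +oo] --> +oo.
    by apply: gt0_cvgMry; [lra | exact: cvg_id].
  have := cvg_comp _ _ h (@cvgr_expR R); rewrite /comp.
  by under eq_fun do rewrite mulNr opprK.
by split; apply: sqr_cvg0 gcvg; near=> t; rewrite -mE ?/m ?lerDl ?lerDr ?sqr_ge0.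
Unshelve. all: by end_near. Qed.

(** * Columns and linear forms along a solution *)

Lemma cvg_col (R : realType) (T : Type) (F : set_system T) (N : nat)
    (f : T -> 'cV[R]_N) (l : 'cV[R]_N) : Filter F ->
  (forall i, f t i 0 @[t --> F] --> l i 0) -> f t @[t --> F] --> l.
Proof.
move=> FF fl; apply/cvg_mx_entourageP => E entE.
have h : \forall t \near F, forall i, E (l i 0, f t i 0).
  by apply: filter_forall => i; have /cvg_entourageP/(_ _ entE) := fl i.
near=> t => i j; rewrite ord1; apply/mem_set.
by move: i; near: t; exact: h.
Unshelve. all: by end_near. Qed.

(** Differentiation commutes with finite linear combinations. Real coefficients [k] make this apply
    to the real and imaginary parts of a complex coordinate. *)
Lemma opinion_form_is_derive (R : realType) (N : nat) (A : 'M[R]_N)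
    (lambda : 'I_N -> R) (x : R -> 'cV[R]_N) (f : 'cV[R]_N -> R)
    (k : 'I_N -> R) :
  (forall y, f y = \sum_i k i * y i 0) -> opinion_solution A lambda x ->
  forall t : R, 0 < t ->
    is_derive t 1 (fun s => f (x s)) (f (opinion_matrix A lambda *m x t)).
Proof.
move=> fE [dx _] t t0.
have dk i : is_derive t 1 (k i \*: (fun s => x s i 0))
    (k i *: opinion_rhs A lambda (x t) i).
  by apply: is_deriveZ; exact: dx.
have := is_derive_sum dk.
have -> : \sum_(i < N) (k i \*: (fun s => x s i 0)) = (fun s => f (x s)).
  by apply/funext => s; rewrite fct_sumE fE.
move=> h; apply: (is_derive_eq h); rewrite fE.
by apply: eq_bigr => i _; rewrite opinion_rhsE.
Qed.

(** A linear form in finitely many entries is continuous, so it inherits right continuity at 0. *)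
Lemma opinion_form_cvg0 (R : realType) (N : nat) (A : 'M[R]_N)
    (lambda : 'I_N -> R) (x : R -> 'cV[R]_N) (f : 'cV[R]_N -> R)
    (k : 'I_N -> R) :
  (forall y, f y = \sum_i k i * y i 0) -> opinion_solution A lambda x ->
  f (x t) @[t --> 0^'+] --> f (x 0).
Proof.
move=> fE [_ x0]; rewrite fE; under eq_fun do rewrite fE.
apply: cvg_big => [|i _]; first exact: add_continuous.
apply: cvgMr.
exact: (cvg_comp x (fun y : 'cV[R]_N => y i 0) x0
  (@coord_continuous _ _ _ i 0 (x 0))).
Qed.

(* Applied to c = coordinate along an eigenvector: c(x(t)) then solves the
   scalar equation c' = nu c. *)
Lemma opinion_coefficient_cvg (R : realType) (N : nat) (A : 'M[R]_N)
    (lambda : 'I_N -> R) (x : R -> 'cV[R]_N) (nu : R[i])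
    (c : 'cV[R]_N -> R[i]) (u : 'I_N -> R[i]) :
  (forall y, c y = \sum_i u i * (y i 0)%:C%C) ->
  (forall y, c (opinion_matrix A lambda *m y) = nu * c y) ->
  nu = 0 \/ complex.Re nu < 0 -> opinion_solution A lambda x ->
  complex.Re (c (x t)) @[t --> +oo] -->
    complex.Re (if nu == 0 then c (x 0) else 0) /\
  complex.Im (c (x t)) @[t --> +oo] -->
    complex.Im (if nu == 0 then c (x 0) else 0).
Proof.
move=> cE cZ nu_lt hx.
(* The entries of y are real, so taking real or imaginary parts affects only the coefficients
   [u]. *)
have ReE y : complex.Re (c y) = \sum_i complex.Re (u i) * y i 0.
  by rewrite cE Re_sum; apply: eq_bigr => i _; rewrite ReM /= mulr0 subr0.
have ImE y : complex.Im (c y) = \sum_i complex.Im (u i) * y i 0.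
  by rewrite cE Im_sum; apply: eq_bigr => i _; rewrite ImM /= mulr0 add0r.
have dRe := opinion_form_is_derive ReE hx.
have dIm := opinion_form_is_derive ImE hx.
have [nu0|nu0] := eqVneq nu 0.
  (* Right continuity at 0 extends constancy on t > 0 to the value at 0. *)
  have cst (f : 'cV[R]_N -> R) (k : 'I_N -> R) :
      (forall y, f y = \sum_i k i * y i 0) ->
      (forall y, f (opinion_matrix A lambda *m y) = 0) ->
      f (x t) @[t --> +oo] --> f (x 0).
    move=> fE fZ; have df := opinion_form_is_derive fE hx.
    have fc (s t : R) : 0 < s -> 0 < t -> f (x s) = f (x t).
      by apply: (@is_derive_pos_cst R (f \o x)) => r /df; rewrite fZ.
    have f1 : f (x t) @[t --> 0^'+] --> f (x 1).
        by apply: cvg_near_cst; near=> t; apply: fc.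
    rewrite (cvg_unique _ (opinion_form_cvg0 fE hx) f1)//.
    by apply: cvg_near_cst; near=> t; apply: fc.
  by split; [apply: (cst (fun y => complex.Re (c y)) _ ReE)
    | apply: (cst (fun y => complex.Im (c y)) _ ImE)] => y;
    rewrite cZ nu0 mul0r.
case: nu_lt => [/eqP|nu_lt]; first by rewrite (negPf nu0).
apply: (@spiral_cvg0 R (fun t => complex.Re (c (x t)))
  (fun t => complex.Im (c (x t))) _ (complex.Im nu) nu_lt) => t t0.
- by rewrite -ReM -cZ; exact: dRe.
- by rewrite -ImM -cZ; exact: dIm.
Unshelve. all: by end_near. Qed.

(** * Assembling the limit from the eigenbasis *)

Theorem theorem2p7 (R : realType) (N : nat) (A : 'M[R]_N) (lambda : 'I_N -> R)
  (nu : 'I_N -> R[i]) (v : 'I_N -> 'cV[R[i]]_N) (x : R -> 'cV[R]_N)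
  (hA : forall i j : 'I_N, 0 <= A i j)
  (hrow : forall i : 'I_N, 0 < \sum_l A i l)
  (hlambda : forall i : 'I_N, 0 < lambda i)
  (hdiag : diagonalizable (complexify (opinion_matrix A lambda)))
  (heig : forall d : 'I_N,
     complexify (opinion_matrix A lambda) *m v d = nu d *: v d)
  (hfree : free [tuple v d | d < N])
  (hx : opinion_solution A lambda x) :
  exists xstar : 'cV[R]_N,
    [/\ steady_state A lambda xstar,
        x t @[t --> +oo] --> xstar &
        complexify xstar =
        \sum_(d < N | nu d == 0)
          coord [tuple v d | d < N] d (complexify (x 0)) *: v d].
Proof.
set Z := opinion_matrix A lambda in hdiag heig *.
set X := [tuple v d | d < N] in hfree *.
have XE (d : 'I_N) : X`_d = v d by rewrite -tnth_nth tnth_mktuple.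
have Xbasis : basis_of fullv X.
  by rewrite basisEfree hfree subvf size_tuple dimvf /dim /= muln1 leqnn.
pose c d y := coord X d (complexify y).
have expand w : w = \sum_d coord X d w *: v d.
  rewrite {1}(coord_basis Xbasis (memvf w)).
  by apply: eq_bigr => d _; rewrite XE.
have v0 d : v d != 0.
  by rewrite -XE; apply: (free_not0 hfree); rewrite mem_nth ?size_tuple.
have nu_lt d : nu d = 0 \/ complex.Re (nu d) < 0.
  exact: opinion_matrix_eigenvalue (heig d) (v0 d).
have cE d y : c d y = \sum_i coord X d (delta_mx i 0) * (y i 0)%:C%C.
  rewrite /c {1}(matrix_sum_delta (complexify y)) linear_sum /=.
  by apply: eq_bigr => i _; rewrite big_ord1 linearZ /= mxE mulrC.
(* Z acts diagonally on the expansion of y in the eigenbasis, and [coord] reads off the factor at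
   d. *)
have cZ d y : c d (Z *m y) = nu d * c d y.
  rewrite /c /complexify map_mxM -/(complexify y) -/(complexify Z).
  rewrite {1}(expand (complexify y)) mulmx_sumr.
  under eq_bigr do rewrite -scalemxAr heig.
  rewrite linear_sum /= (bigD1 d)//= big1 => [|e ed].
    by rewrite !linearZ /= -XE coord_free// eqxx mulr1 addr0 mulrC.
  by rewrite !linearZ /= -XE coord_free// (negPf ed) !mulr0.
have coef_cvg d := opinion_coefficient_cvg (cE d) (cZ d) (nu_lt d) hx.
pose S := \sum_(d < N | nu d == 0) c d (x 0) *: v d.
(* Padding with zero coefficients matches the limits in [coef_cvg] term by term. *)
have SE i : S i 0 = \sum_d (if nu d == 0 then c d (x 0) else 0) * v d i 0.
  rewrite /S summxE big_mkcond /=; apply: eq_bigr => d _.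
  by case: ifP => _; rewrite ?mul0r ?mxE.
have xE t i : (x t i 0)%:C%C = \sum_d c d (x t) * v d i 0.
  have /colP/(_ i) := expand (complexify (x t)).
  by rewrite mxE summxE => ->; apply: eq_bigr => d _; rewrite mxE.
have Re_cvg i : x t i 0 @[t --> +oo] --> complex.Re (S i 0).
  have -> : (fun t => x t i 0) =
      (fun t => \sum_d complex.Re (c d (x t) * v d i 0)).
    by apply/funext => t; rewrite -Re_sum -xE.
  rewrite SE Re_sum; apply: cvg_big => [|d _]; first exact: add_continuous.
  rewrite ReM; under eq_fun do rewrite ReM.
  by case: (coef_cvg d) => cRe cIm; apply: cvgB; apply: cvgMl.
(* The imaginary part of x(t) is constantly 0, yet its expansion tends to that of S; uniqueness of
   limits makes S real. *)
have Im_cvg i : (0 : R) @[t --> (+oo : set_system R)] --> complex.Im (S i 0).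
  have -> : (fun t : R => 0 : R) =
      (fun t => \sum_d complex.Im (c d (x t) * v d i 0)).
    by apply/funext => t; rewrite -Im_sum -xE.
  rewrite SE Im_sum; apply: cvg_big => [|d _]; first exact: add_continuous.
  rewrite ImM; under eq_fun do rewrite ImM.
  by case: (coef_cvg d) => cRe cIm; apply: cvgD; apply: cvgMl.
have ImS i : complex.Im (S i 0) = 0.
  by apply: (cvg_unique _ (Im_cvg i)); [|exact: cvg_cst].
pose xstar := \col_i complex.Re (S i 0).
have xstarE : complexify xstar = S.
  apply/colP => i; rewrite !mxE.
  by case: (S i 0) (ImS i) => a b /= ->.
exists xstar; split => //.
- move=> i; rewrite opinion_rhsE.
  (* Checked over [R[i]], where Z kills every eigenvector kept in S; injectivity of the embedding
     brings this back to the reals. *)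
  suff -> : opinion_matrix A lambda *m xstar = 0 by rewrite mxE.
  apply: (@map_mx_inj _ _ (real_complex R)).
  rewrite map_mxM map_mx0 -/(complexify xstar) xstarE mulmx_sumr big1 // => d.
  by move=> /eqP nud0; rewrite -scalemxAr heig nud0 scale0r scaler0.
- by apply: cvg_col => i; rewrite mxE.
Qed.
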